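(* Let $w$ be a word over $\{a,b\}$ with Parikh image $(p,q)$. Suppose that the support of $\delta_w$ is symmetric, i.e. for all $0\le i\le p$, $0\le j\le q$ one has $\delta_w(i,j)>0$ if and only if $\delta_w(p-i,q-j)>0$ (this holds in particular if $w$ is strongly factor-symmetric). If moreover $w$ is primitive and Sturmian, then $w$ is a Christoffel word.
   Context: Words are finite words over $\{a,b\}$. A factor of a word $w$ is a contiguous subword (including the empty word and $w$ itself). The Parikh image of a word $x$ is $(|x|_a,|x|_b)$. For a word $w$, $\delta_w(i,j)$ denotes the number of distinct factors of $w$ with Parikh image $(i,j)$. A word $w$ with Parikh image $(p,q)$ is strongly factor-symmetric if $\delta_w(i,j)=\delta_w(p-i,q-j)$ for all $0\le i\le p$, $0\le j\le q$. A word is primitive if it is not equal to $u^k$ for any word $u$ and integer $k\ge2$. A palindrome is a word equal to its reversal. A Christoffel word is either $a$, or $b$, or a word $w=amb$ or $w=bma$ with $m$ a palindrome and $w$ a product of two palindromes. A (finite) Sturmian word is a word that is a factor of some Christoffel word. *)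

(* Defs.v *)
From mathcomp Require Import all_boot.

Set Implicit Arguments.
Unset Strict Implicit.
Unset Printing Implicit Defensive.

(* The alphabet {a, b} is bool, with a = false and b = true. *)
Definition la : bool := false.
Definition lb : bool := true.

Definition word := seq bool.

Definition parikh (x : word) : nat * nat := (count_mem la x, count_mem lb x).

(* [infix x w] says that x is a (contiguous) factor of w. A factor of w has
   length at most [size w], so the bounded sequences contain all of them. *)
Definition delta (w : word) (i j : nat) : nat :=
  #|[set x : (size w).-bseq bool | infix x w & parikh x == (i, j)]|.

Definition strongly_factor_symmetric (w : word) : Prop :=
  let: (p, q) := parikh w in
  forall i j : nat, i <= p -> j <= q -> delta w i j = delta w (p - i) (q - j).

Definition support_symmetric (w : word) : Prop :=
  let: (p, q) := parikh w in
  forall i j : nat, i <= p -> j <= q ->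
    (0 < delta w i j <-> 0 < delta w (p - i) (q - j)).

(* [flatten (nseq k u)] is the power u^k. The empty word is not primitive. *)
Definition primitive (w : word) : Prop :=
  ~ exists (u : word) (k : nat), 2 <= k /\ w = flatten (nseq k u).

Definition palindrome (w : word) : Prop := rev w = w.

Definition christoffel (w : word) : Prop :=
  w = [:: la] \/ w = [:: lb] \/
  ((exists m : word, palindrome m /\
      (w = la :: rcons m lb \/ w = lb :: rcons m la)) /\
   (exists u v : word, palindrome u /\ palindrome v /\ w = u ++ v)).

Definition sturmian (w : word) : Prop :=
  exists c : word, christoffel c /\ infix w c.

(* Main.v *)
Require Import Defs.
From mathcomp Require Import all_boot.
From mathcomp Require Import zify.

(** Let [n] be the length of [w], [q] its number of letters b, and let
    D(i) be [n] times the number of b's among the first i letters, minus [q i].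
    In a Christoffel word a m b = u v, reflecting in m and then in u, v shows
    that i -> i + |u| (mod n) changes D by a constant away from i = 0; hence D
    ranges over an interval of length less than n, so Christoffel words and
    their factors are balanced.  If the support of delta is symmetric, every
    cyclic window of [w] has as many b's as some linear factor of the same
    length, so [w] is cyclically balanced; averaging over the cyclic windows
    gives |D(i) - D(j)| < n.  If [w] is primitive, [n] and [q] are coprime, so
    D takes n consecutive values.  A factor joining the extreme points i, j of
    D has a complementary factor along which D varies oppositely; it fits into
    [w] only if one extreme point is the left end, and then [w] is the
    discretisation of a line from below or above, that is, Christoffel. *)

(** * Prefix counts of the letter b *)

Definition ones (w : word) (i : nat) : nat := count_mem lb (take i w).

Lemma ones0 w : ones w 0 = 0.
Proof. by rewrite /ones take0. Qed.

Lemma ones_oversize w i : size w <= i -> ones w i = count_mem lb w.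
Proof. by move=> h; rewrite /ones take_oversize. Qed.

Lemma onesS w i : i < size w -> ones w i.+1 = ones w i + nth la w i.
Proof.
move=> h; rewrite /ones (take_nth la h) -cats1 count_cat /= addn0.
by case: (nth _ _ _).
Qed.

Lemma onesD w i l : ones w (i + l) = ones w i + ones (drop i w) l.
Proof. by rewrite /ones takeD count_cat. Qed.

Lemma ones_cat (u v : word) i : ones (u ++ v) (size u + i) = count_mem lb u + ones v i.
Proof. by rewrite onesD drop_size_cat // /ones take_size_cat. Qed.

Lemma ones_catl (u v : word) i : i <= size u -> ones (u ++ v) i = ones u i.
Proof. by move=> h; rewrite /ones takel_cat. Qed.

Lemma ones_rev w i :
  i <= size w -> ones (rev w) i + ones w (size w - i) = count_mem lb w.
Proof.
move=> h; rewrite /ones take_rev count_rev addnC -count_cat.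
by rewrite cat_take_drop.
Qed.

Lemma eq_from_ones (x y : word) :
  size x = size y -> (forall i, i <= size x -> ones x i = ones y i) -> x = y.
Proof.
move=> szE onesE; apply: (eq_from_nth (x0 := la)) => // i lti.
have := onesE i.+1 lti; rewrite !onesS -?szE // onesE; last exact: ltnW.
by move=> /addnI; case: (nth _ x i) (nth _ y i) => [] [].
Qed.

Lemma palindromeP (x : word) : palindrome x <->
  forall i, i <= size x -> ones x i + ones x (size x - i) = count_mem lb x.
Proof.
split=> [pal i lei | onesE]; first by rewrite -{1}pal ones_rev.
apply: eq_from_ones => [|i]; rewrite size_rev // => lei.
by have := ones_rev _ _ lei; have := onesE _ lei; lia.
Qed.

Lemma infix_ones (x w : word) : infix x w ->
  exists2 i, i + size x <= size w &
    ones w i + count_mem lb x = ones w (i + size x).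
Proof.
case/infixP=> s [s' ->]; exists (size s); first by rewrite !size_cat leq_add2l leq_addr.
by rewrite onesD drop_size_cat // {3}/ones take_size_cat.
Qed.

Lemma ones_infix (w : word) i l : i + l <= size w ->
  exists x : word, [/\ infix x w, size x = l &
                ones w i + count_mem lb x = ones w (i + l)].
Proof.
move=> le; exists (take l (drop i w)); split; last by rewrite onesD.
  by apply/infixP; exists (take i w), (drop l (drop i w)); rewrite !cat_take_drop.
by rewrite size_takel // size_drop; lia.
Qed.

Lemma count_la_lb (x : word) : count_mem la x + count_mem lb x = size x.
Proof. by elim: x => //= -[] x /=; lia. Qed.

(** * Factors and symmetry of the support *)

Lemma delta_gt0P w i j :
  0 < delta w i j <-> exists2 x : word, infix x w & parikh x = (i, j).
Proof.
split=> [/card_gt0P [x]|[x xw xE]].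
  by rewrite inE => /andP [xw /eqP]; exists x.
by apply/card_gt0P; exists (Bseq (size_infix xw)); rewrite inE xw xE /=.
Qed.

(** [delta] is positive at the Parikh image of [x], hence at the complementary one, where any
    witness serves as [y]. Later arguments use the symmetry only in this form. *)
Lemma symmetric_complement (w x : word) : support_symmetric w -> infix x w ->
  exists y : word, [/\ infix y w, size x + size y = size w &
                count_mem lb x + count_mem lb y = count_mem lb w].
Proof.
rewrite /support_symmetric /parikh => sym xw.
have lea := leq_count_subseq (pred1 la) (infixW xw).
have leb := leq_count_subseq (pred1 lb) (infixW xw).
have /(sym _ _ lea leb) : 0 < delta w (count_mem la x) (count_mem lb x).
  by apply/delta_gt0P; exists x.
case/delta_gt0P=> y yw [ya yb]; exists y; split=> //; last by rewrite yb subnKC.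
by rewrite -!count_la_lb ya yb addnACA !subnKC.
Qed.

(** * Balance and the slope bound *)

Definition balanced (w : word) : Prop := forall x y : word,
  infix x w -> infix y w -> size x = size y ->
  count_mem lb x <= count_mem lb y + 1.

Lemma balanced_infix (w c : word) : infix w c -> balanced c -> balanced w.
Proof.
by move=> wc bc x y xw yw; apply: bc; [apply: infix_trans wc | apply: infix_trans wc].
Qed.

Lemma balanced_rev w : balanced (rev w) -> balanced w.
Proof.
move=> bw x y xw yw sz; rewrite -(count_rev _ x) -(count_rev _ y).
by apply: bw; rewrite ?infix_rev ?size_rev.
Qed.

(** This is D(i) - D(j) < n with the subtracted terms moved across, to stay in [nat]. Exchanging [i]
    and [j] bounds the absolute value. *)
Definition slope_bounded (w : word) : Prop := forall i j,
  i <= size w -> j <= size w ->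
  size w * ones w i + count_mem lb w * j
    < size w * ones w j + count_mem lb w * i + size w.

(** D rises by less than n along [x] and falls by less than n along [y]. The lengths agree, so n
    times the difference of the counts is below 2n. *)
Lemma slope_bounded_balanced w : slope_bounded w -> balanced w.
Proof.
move=> sb x y /infix_ones [i lei iE] /infix_ones [j lej jE] sz.
have lei' : i <= size w by lia.
have lej' : j <= size w by lia.
rewrite -sz in lej jE.
have h1 := sb _ _ lei lei'; have h2 := sb _ _ lej' lej.
rewrite -iE in h1; rewrite -jE in h2.
rewrite leqNgt; apply/negP=> lt.
have : size w * (count_mem lb y + 2) <= size w * count_mem lb x.
  by rewrite leq_mul2l; lia.
lia.
Qed.

(** * Summation over cyclic windows *)

Lemma sum_shift (f : nat -> nat) n q l :
  (forall k, k < l -> f (n + k) = f k + q) ->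
  \sum_(0 <= i < n) f (i + l) = \sum_(0 <= i < n) f i + l * q.
Proof.
elim: l => [_|l IH fE].
  by rewrite addn0; apply: eq_bigr => i _; rewrite addn0.
have: f l + \sum_(0 <= i < n) f (i + l.+1) = \sum_(0 <= i < n) f (i + l) + f (n + l).
  rewrite -(big_nat_recr n 0 (fun i => f (i + l))) // big_nat_recl //.
  by congr (_ + _); apply: eq_bigr => i _; rewrite addnS addSn.
by rewrite IH => [|k ltk]; [rewrite fE //; lia | apply: fE; lia].
Qed.

Lemma ones_double w k : k <= size w ->
  ones (w ++ w) (size w + k) = ones (w ++ w) k + count_mem lb w.
Proof. by move=> le; rewrite ones_cat (ones_catl w w) // addnC. Qed.

(** Reading in [w ++ w] unrolls the circle: every letter of [w] lies in exactly [l] cyclic windows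
    of length [l]. *)
Lemma sum_windows w l : l <= size w ->
  \sum_(0 <= i < size w) ones (w ++ w) (i + l)
  = \sum_(0 <= i < size w) ones (w ++ w) i + l * count_mem lb w.
Proof. by move=> le; apply: sum_shift => k lt; apply: ones_double; lia. Qed.

(** * Christoffel words are balanced *)

Lemma christoffel_slope (m u v : word) :
  palindrome m -> palindrome u -> palindrome v ->
  la :: rcons m lb = u ++ v -> slope_bounded (la :: rcons m lb).
Proof.
move=> pm pu pv cE; set c := la :: rcons m lb in cE *.
(* If [u] or [v] were empty, [c] would be a palindrome with different end letters. *)
have u0 : 0 < size u.
  case: u pu cE => // _ /= cE; move: pv; rewrite /palindrome -cE /c.
  by rewrite rev_cons rev_rcons.
have v0 : 0 < size v.
  case: v pv cE => // _; rewrite cats0 => cE; move: pu; rewrite /palindrome -cE /c.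
  by rewrite rev_cons rev_rcons.
pose n := size c; pose q := count_mem lb c; pose r := size u.
have nE : n = r + size v by rewrite /n cE size_cat.
have nm : n = (size m).+2 by rewrite /n /c /= size_rcons.
have qm : q = (count_mem lb m).+1 by rewrite /q /c /= -cats1 count_cat /= addn1.
have qE : q = count_mem lb u + count_mem lb v by rewrite /q cE count_cat.
have onesm i : i <= size m -> ones c i.+1 = ones m i.
  by move=> le; rewrite /c /ones /= -cats1 takel_cat.
have onesu i : i <= r -> ones c i = ones u i by rewrite cE; apply: ones_catl.
have onesv i : ones c (r + i) = count_mem lb u + ones v i by rewrite cE ones_cat.
have onesr : ones c r = count_mem lb u by rewrite onesu // ones_oversize.
(* The two prefixes jointly count the letters b of [m]; the 1 is the final b of [c]. *)
have refl_m i : 0 < i < n -> ones c i + ones c (n - i) + 1 = q.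
  case: i => // i lti; have le : i <= size m by lia.
  have /palindromeP /(_ _ le) := pm.
  rewrite (_ : n - i.+1 = (size m - i).+1); last by lia.
  by rewrite !onesm; lia.
have refl_u i : i <= r -> ones c i + ones c (r - i) = ones c r.
  by move=> le; have /palindromeP /(_ _ le) := pu; rewrite -/r onesr !onesu; lia.
have refl_v i : i <= size v -> ones c (r + i) + ones c (n - i) = q + ones c r.
  move=> le; have /palindromeP /(_ _ le) := pv.
  rewrite (_ : n - i = r + (size v - i)); last by lia.
  by rewrite onesr !onesv; lia.
have up i : i < r -> ones c (size v + i) + 1 + ones c r = q + ones c i.
  move=> lt; have := refl_u i ltac:(lia); have := refl_m (r - i) ltac:(lia).
  by rewrite (_ : n - (r - i) = size v + i); lia.
have down i : 0 < i -> i <= size v -> ones c (r + i) = ones c i + 1 + ones c r.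
  by move=> i0 le; have := refl_v i le; have := refl_m i ltac:(lia); lia.
(* By [up] and [down], every cyclic window of length [r] has [1 + ones c r] letters b, except the
   one at 0, which has one fewer. The total is [r * q]. *)
have slope : n * (1 + ones c r) = q * r + 1.
  have := sum_windows c r ltac:(lia).
  rewrite -/n -/q nm big_ltn // [X in _ = X + _]big_ltn //.
  have -> : \sum_(1 <= i < (size m).+2) ones (c ++ c) (i + r) =
            \sum_(1 <= i < (size m).+2) (ones (c ++ c) i + (1 + ones c r)).
    apply: eq_big_nat => i lti; rewrite (ones_catl c c i) -/n; last by lia.
    case: (leqP i (size v)) => [le|lt].
      by rewrite ones_catl -/n; [rewrite addnC down; lia | lia].
    have := up (i - size v) ltac:(lia); rewrite subnKC; last by lia.
    rewrite (_ : i + r = n + (i - size v)); last by lia.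
    by rewrite ones_cat -/q; lia.
  rewrite big_split /= sum_nat_const_nat (add0n r).
  rewrite (ones_catl c c r) -/n ?ones0; last by lia.
  by lia.
(* D(i), shifted by [n q] to stay in [nat]. *)
pose g i := n * ones c i + q * (n - i).
(* With [gdown]: moving by [r] modulo [n] raises [g] by 1 from every point but 0. So the maximum of
   [g] is at 0 and the minimum at [r]. *)
have gup i : i < r -> g (size v + i) + 1 = g i.
  move=> lt; rewrite /g.
  have e : n * (ones c (size v + i) + 1 + ones c r) = n * (q + ones c i).
    by rewrite up.
  have -> : n - (size v + i) = r - i by lia.
  have : q * (n - i) = q * (size v) + q * (r - i) by rewrite -mulnDr; congr (_ * _); lia.
  have : q * n = q * r + q * size v by rewrite nE mulnDr.
  by lia.
have gdown i : 0 < i -> i <= size v -> g (r + i) = g i + 1.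
  move=> i0 le; rewrite /g down // -addnA mulnDr slope.
  have : q * (n - i) = q * r + q * (n - (r + i)) by rewrite -mulnDr; congr (_ * _); lia.
  by lia.
have c0 : 0 < n by lia.
have gmax i : i <= n -> g i <= n * q.
  have [-> _|nlt lei] := eqVneq i n; first by rewrite /g subnn /n ones_oversize -/q; lia.
  have lti : i < n by lia.
  case: (@arg_maxnP _ (Ordinal c0) xpredT (fun k : 'I_n => g k) isT) => k _ kmax.
  have := kmax (Ordinal lti) isT => /= /leq_trans; apply.
  have [->|k0] := posnP k; first by rewrite /g ones0; lia.
  case: (ltnP k (size v)) => [ltk|lek].
    have lt : r + k < n by lia.
    by have := kmax (Ordinal lt) isT => /=; rewrite gdown //; lia.
  have lt : k - size v < n by have := ltn_ord k; lia.
  have := kmax (Ordinal lt) isT => /=.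
  have := gup (k - size v) ltac:(have := ltn_ord k; lia).
  by rewrite subnKC //; lia.
have gr : g r + n = n * q + 1.
  rewrite /g (_ : n - r = size v); last by lia.
  have : q * n = q * r + q * size v by rewrite nE mulnDr.
  by lia.
have gmin i : i <= n -> n * q + 1 <= g i + n.
  have [-> _|nlt lei] := eqVneq i n; first by rewrite /g subnn /n ones_oversize -/q; lia.
  have lti : i < n by lia.
  case: (@arg_minnP _ (Ordinal c0) xpredT (fun k : 'I_n => g k) isT) => k _ kmin.
  have := kmin (Ordinal lti) isT => /= le.
  suff : g r <= g k by lia.
  case: (ltngtP k r) => [ltk|ltk|-> //].
    have lt : size v + k < n by lia.
    by have := kmin (Ordinal lt) isT => /=; have := gup k ltk; lia.
  have lt : k - r < n by have := ltn_ord k; lia.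
  have := kmin (Ordinal lt) isT => /=.
  have := gdown (k - r) ltac:(lia) ltac:(have := ltn_ord k; lia).
  by rewrite subnKC; lia.
move=> i j lei lej; rewrite -/n -/q in lei lej *.
have := gmax i lei; have := gmin j lej; rewrite /g.
have : q * n = q * i + q * (n - i) by rewrite -mulnDr subnKC.
have : q * n = q * j + q * (n - j) by rewrite -mulnDr subnKC.
lia.
Qed.

(** Reversal reduces b m a to a m b and swaps the two palindromic factors. *)
Lemma christoffel_balanced c : christoffel c -> balanced c.
Proof.
have small (l : bool) : balanced [:: l].
  move=> x y /size_infix /= sx _ sxy.
  by apply: leq_trans (count_size _ x) (leq_trans sx _); rewrite addn1.
case=> [->|[->|[[m [pm cE]] [u [v [pu [pv uv]]]]]]] //.
case: cE uv => -> uv; first exact/slope_bounded_balanced/(christoffel_slope m u v).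
apply: balanced_rev; apply: slope_bounded_balanced.
have E : rev (lb :: rcons m la) = la :: rcons m lb.
  by rewrite rev_cons rev_rcons pm.
rewrite E; apply: (christoffel_slope m v u) => //.
by rewrite -E uv rev_cat pu pv.
Qed.

(** * From symmetric support to the slope bound *)

Lemma symmetric_slope w :
  0 < size w -> support_symmetric w -> balanced w -> slope_bounded w.
Proof.
move=> n0 sym bal; pose n := size w; pose q := count_mem lb w.
have cyclic i l : i < n -> l <= n -> exists x : word,
    [/\ infix x w, size x = l &
        ones (w ++ w) (i + l) = ones (w ++ w) i + count_mem lb x].
  move=> lti lel; rewrite (ones_catl w w i); last exact: ltnW.
  case: (leqP (i + l) n) => [le|lt].
    have [x [xw sx xE]] := ones_infix w i l le.
    by exists x; split=> //; rewrite ones_catl.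
  (* The window wraps round the end; what it leaves out is the linear factor [x], whose complement
     [y] has the length and count of the window. *)
  have [|x [xw sx xE]] := ones_infix w (i + l - n) (n - l); first by rewrite -/n; lia.
  have [y [yw sy yE]] := symmetric_complement w x sym xw.
  exists y; split=> //; first by rewrite -/n in sy; lia.
  rewrite (_ : i + l = n + (i + l - n)); last by lia.
  rewrite ones_cat; move: xE.
  by rewrite (_ : i + l - n + (n - l) = i); lia.
(* The window at [i] differs by at most 1 from each of the [n] cyclic windows
   and by 0 from itself, and these contain [l q] letters b in total. *)
have close i l : i < n -> l <= n ->
    n * ones (w ++ w) (i + l) < n * ones (w ++ w) i + q * l + n /\
    n * ones (w ++ w) i + q * l < n * ones (w ++ w) (i + l) + n.
  move=> lti lel; have [x [xw sx xE]] := cyclic i l lti lel.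
  have near k : k < n ->
      ones (w ++ w) (k + l) <= ones (w ++ w) k + count_mem lb x + (k != i) /\
      ones (w ++ w) k + count_mem lb x <= ones (w ++ w) (k + l) + (k != i).
    move=> ltk; have [->|_] := eqVneq k i; first by lia.
    have [y [yw sy yE]] := cyclic k l ltk lel.
    have := bal x y xw yw ltac:(lia); have := bal y x yw xw ltac:(lia).
    by lia.
  have sumne : \sum_(0 <= k < n) (k != i) = n - 1.
    have: \sum_(0 <= k < n) (k != i) + \sum_(0 <= k < n) (k == i) = n.
      rewrite -big_split /= (eq_bigr (fun=> 1)) => [|k _]; last by case: eqP.
      by rewrite sum_nat_const_nat; lia.
    rewrite [X in _ + X](eq_bigr (fun k => if k == i then 1 else 0)).
      2: by move=> k _; case: eqP.
    by rewrite -[X in _ + X]big_mkcond big_nat1_eq lti /=; lia.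
  have S := sum_windows w l lel; rewrite -/n -/q in S.
  have U : \sum_(0 <= k < n) ones (w ++ w) (k + l) <=
           \sum_(0 <= k < n) (ones (w ++ w) k + count_mem lb x + (k != i)).
    by rewrite !big_nat; apply: leq_sum => k /andP [_ lt]; have [] := near k lt.
  have L : \sum_(0 <= k < n) (ones (w ++ w) k + count_mem lb x) <=
           \sum_(0 <= k < n) (ones (w ++ w) (k + l) + (k != i)).
    by rewrite !big_nat; apply: leq_sum => k /andP [_ lt]; have [] := near k lt.
  rewrite !big_split /= sum_nat_const_nat subn0 sumne in U.
  rewrite !big_split /= sum_nat_const_nat subn0 sumne in L.
  move: U L; rewrite S xE mulnDr /=; move: (\sum_(_ <= _ < _) _) => z.
  by lia.
have ordered i j : i <= j -> j <= n ->
    n * ones w j < n * ones w i + q * (j - i) + n /\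
    n * ones w i + q * (j - i) < n * ones w j + n.
  (* [close] requires [i < n], so the end point is treated apart. *)
  move=> le lej; have [eqin|ne] := eqVneq i n.
    have -> : j = n by lia.
    rewrite eqin.
    by rewrite subnn -/n in n0 *; lia.
  have := close i (j - i) ltac:(lia) ltac:(lia); rewrite subnKC //.
  by rewrite !ones_catl //; lia.
move=> i j lei lej; rewrite -/n -/q in lei lej *.
case: (leqP i j) => [le|/ltnW le].
  have [_] := ordered i j le lej.
  have : q * j = q * i + q * (j - i) by rewrite -mulnDr subnKC.
  by lia.
have [+ _] := ordered j i le lei.
have : q * i = q * j + q * (i - j) by rewrite -mulnDr subnKC.
by lia.
Qed.

(** * Primitivity and coprimality *)

Lemma flatten_periodic (w : word) d l :
  size w = d * l -> drop l w = take (size w - l) w ->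
  w = flatten (nseq d (take l w)).
Proof.
elim: d w => [|d IH] w sz per /=; first exact: size0nil.
rewrite -[LHS](cat_take_drop l w); congr (_ ++ _).
have [d0|d0] := posnP d.
  by rewrite d0 /=; apply: drop_oversize; rewrite sz d0 mul1n.
have lel : l <= size w - l by rewrite sz mulSn addKn leq_pmull.
have tE : take l (drop l w) = take l w by rewrite per take_takel.
rewrite [LHS]IH ?tE //; first by rewrite size_drop sz mulSn addKn.
by rewrite size_drop {1}per take_drop subnK.
Qed.

Lemma primitive_gt0 w : primitive w -> 0 < size w.
Proof.
move=> prim; rewrite lt0n; apply/eqP=> /size0nil w0.
by apply: prim; exists [::], 2; rewrite w0.
Qed.

(** For a gcd d > 1, put n = l d and q = k d. Over a factor of length l, D changes by a multiple of
    n smaller than n in absolute value, hence by 0. Each such factor then has k letters b, so [w]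
    has period l and is a d-th power. *)
Lemma primitive_coprime w :
  primitive w -> slope_bounded w -> coprime (size w) (count_mem lb w).
Proof.
move=> prim sb; set n := size w; set q := count_mem lb w.
have n0 : 0 < n by apply: primitive_gt0.
apply/eqP; case: (eqVneq (gcdn n q) 1) => // gn1; exfalso; pose d := gcdn n q.
have d0 : 0 < d by rewrite gcdn_gt0 n0.
have d1 : 1 < d by move: gn1; rewrite -/d; lia.
case/dvdnP: (dvdn_gcdl n q) => l nE; case/dvdnP: (dvdn_gcdr n q) => k qE.
rewrite -/d in nE qE.
have shift i : i + l <= n -> ones w (i + l) = ones w i + k.
  move=> le; have := sb i (i + l) ltac:(rewrite -/n; lia) le.
  have := sb (i + l) i le ltac:(rewrite -/n; lia).
  rewrite -/n -/q; have -> : q * (i + l) = q * i + n * k by rewrite nE qE; lia.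
  move=> h1 h2.
  have : n * ones w (i + l) < n * (ones w i + k + 1) by lia.
  have : n * (ones w i + k) < n * (ones w (i + l) + 1) by lia.
  by rewrite !ltn_pmul2l //; lia.
apply: prim; exists (take l w), d; split=> //.
have lel : l <= n by rewrite nE; apply: leq_pmulr; lia.
have lk : ones w l = k by rewrite -(add0n l) shift // ones0.
apply: flatten_periodic; first by rewrite -/n nE mulnC.
apply: eq_from_ones; rewrite size_drop; first by rewrite size_takel // leq_subr.
move=> i lei; rewrite -/n in lei *.
rewrite [RHS]/ones take_takel // -/(ones w i).
by have := onesD w l i; rewrite addnC shift; lia.
Qed.

(** * Discretised lines are Christoffel words *)

Lemma eq_of_slope n q a b i j : coprime n q -> i < n -> j < n ->
  n * a + q * i = n * b + q * j -> i = j.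
Proof.
move=> co; wlog le : a b i j / i <= j => [H|] lti ltj e.
  by case: (leqP i j) => [|/ltnW] le; [apply: (H a b) | apply/esym/(H b a)].
have : n %| q * (j - i).
  rewrite mulnBr; have -> : q * j - q * i = n * (a - b) by rewrite mulnBr; lia.
  exact: dvdn_mulr.
by rewrite Gauss_dvdr // => /dvdn_leq; lia.
Qed.

(** The hypotheses say that [ones w i] is the floor of q i / n and that q r is -1 modulo n. The
    symmetries of the floor function make the middle of [w] a palindrome, as well as the two pieces
    cut at [r]. *)
Lemma floor_slope_christoffel w r : 
  coprime (size w) (count_mem lb w) -> 1 < size w ->
  (forall i, i <= size w -> size w * ones w i <= count_mem lb w * i) ->
  (forall i, i <= size w -> count_mem lb w * i < size w * ones w i + size w) ->
  r < size w -> count_mem lb w * r + 1 = size w * (ones w r + 1) ->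
  christoffel w.
Proof.
pose n := size w; pose q := count_mem lb w; rewrite -/n -/q => co n1 lo hi ltr rE.
have q0 : 0 < q.
  rewrite lt0n; apply/eqP => q0; move: co; rewrite q0 /coprime gcdn0; lia.
have qn : q < n.
  rewrite ltn_neqAle count_size andbT; apply/eqP => qn.
  by move: co; rewrite qn /coprime gcdnn; lia.
have on : ones w n = q by apply: ones_oversize.
have lt_small a b : n * a < n * b -> a < b by rewrite ltn_pmul2l //; lia.
have refl_m i : 0 < i < n -> ones w i + ones w (n - i) + 1 = q.
  move=> /andP [i0 lti].
  (* By coprimality the line meets no lattice point strictly between its ends, so [lo] is strict
     there. *)
  have ne k : 0 < k < n -> n * ones w k != q * k.
    move=> /andP [k0 ltk]; apply/eqP => e.
    by have := eq_of_slope n q (ones w k) 0 0 k co ltac:(lia) ltk ltac:(lia); lia.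
  have := ne i ltac:(lia); have := ne (n - i) ltac:(lia).
  have := lo i ltac:(lia); have := hi i ltac:(lia).
  have := lo (n - i) ltac:(lia); have := hi (n - i) ltac:(lia).
  have : q * n = q * i + q * (n - i) by rewrite -mulnDr subnKC; lia.
  move=> *.
  have := lt_small (ones w i + ones w (n - i)) q ltac:(lia).
  have := lt_small q (ones w i + ones w (n - i) + 2) ltac:(lia).
  by lia.
(* The remainders of q i and q j modulo n add up to -1 modulo n. Their sum is at most 2n - 2, so it
   is n - 1 and the floors add without carry. *)
have refl i j k : q * (i + j) + 1 = n * (k + 1) -> i <= n -> j <= n ->
    ones w i + ones w j = k.
  rewrite mulnDr => e lei lej.
  have := lo i lei; have := hi i lei; have := lo j lej; have := hi j lej => *.
  have := lt_small (ones w i + ones w j) (k + 1) ltac:(lia).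
  have := lt_small (k + 1) (ones w i + ones w j + 2) ltac:(lia).
  by lia.
right; right; split; last first.
  exists (take r w), (drop r w); rewrite cat_take_drop; split; last split=> //.
    apply/palindromeP => i; rewrite size_takel; last exact: ltnW.
    move=> le; rewrite /ones !take_takel //; last exact: leq_subr.
    by apply: refl; [rewrite subnKC | lia..].
  apply/palindromeP => i; rewrite size_drop -/n => le.
  have E : q = ones w r + count_mem lb (drop r w).
    by rewrite /q -{1}(cat_take_drop r w) count_cat.
  have := onesD w r i; have := onesD w r (n - r - i).
  suff : ones w (r + i) + ones w (r + (n - r - i)) = q + ones w r by move: E => /=; lia.
  apply: refl; [|lia..].
  have -> : r + i + (r + (n - r - i)) = r + n by lia.
  by rewrite mulnDr; lia.
have [x [m [y wE]]] : exists (x : bool) (m : word) (y : bool), w = x :: rcons m y.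
  move: n1; rewrite /n; case: (w) => [|x s] //; case/lastP: s => [|m y] // _.
  by exists x, m, y.
have nm : n = (size m).+2 by rewrite /n wE /= size_rcons.
have onesm i : i <= size m -> ones w i.+1 = x + ones m i.
  by move=> le; rewrite wE /ones /= -cats1 takel_cat //; case: (x).
have qE : q = x + count_mem lb m + y.
  by rewrite /q wE /= -cats1 count_cat /=; case: (x); case: (y); rewrite /= /lb; lia.
have x0 : x = la.
  have := lo 1 ltac:(lia); rewrite onesm // ones0; case: (x) => //= h; exfalso; lia.
have y1 : y = lb.
  have := lo n.-1 ltac:(lia); rewrite {2 3}nm /= onesm // ones_oversize //.
  case: (y) qE => //= qE; rewrite (_ : x + _ = q); last by lia.
  by rewrite mulnC leq_pmul2l => [le|//]; exfalso; lia.
exists m; split; last by left; rewrite wE x0 y1.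
apply/palindromeP => i le; have := refl_m i.+1 ltac:(lia).
rewrite (_ : n - i.+1 = (size m - i).+1); last by lia.
by rewrite !onesm ?leq_subr // qE x0 y1 /=; lia.
Qed.

(** * From the slope bound to Christoffel words *)

Lemma christoffel_rev w : christoffel (rev w) -> christoffel w.
Proof.
move=> h; rewrite -(revK w); case: h => [->|[->|[[m [pm wE]] [u [v [pu [pv uv]]]]]]].
- by left.
- by right; left.
right; right; split; last first.
  by exists v, u; split=> //; split=> //; rewrite uv rev_cat pu pv.
exists m; split=> //; case: wE => ->; [right | left]; by rewrite rev_cons rev_rcons pm.
Qed.

Lemma slope_bounded_christoffel w : primitive w -> support_symmetric w ->
  slope_bounded w -> christoffel w.
Proof.
move=> prim sym sb; have co := primitive_coprime w prim sb.
pose n := size w; pose q := count_mem lb w; rewrite -/n -/q in co.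
have n0 : 0 < n by apply: primitive_gt0.
have [n1|n1] := leqP n 1.
  move: n0 n1; rewrite /n; case: (w) => [|[] [|]] // _ _; [by right; left | by left].
have on : ones w n = q by apply: ones_oversize.
have mul_lt a b : n * a < n * b -> a < b by rewrite ltn_pmul2l //; lia.
(* As before, D(i) + [n q]. *)
pose g i := n * ones w i + q * (n - i).
have gE i : i <= n -> g i + q * i = n * ones w i + q * n.
  by move=> le; rewrite /g -addnA -mulnDr subnK.
have gclose i j : i <= n -> j <= n -> g i < g j + n.
  move=> lei lej; have := sb i j lei lej; rewrite -/n -/q.
  by have := gE i lei; have := gE j lej; lia.
have ginj i j : i < n -> j < n -> g i = g j -> i = j.
  move=> lti ltj e; apply: (eq_of_slope n q (ones w j) (ones w i)) => //.
  by have := gE i ltac:(lia); have := gE j ltac:(lia); lia.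
have g0 : g 0 = n * q by rewrite /g ones0 subn0; lia.
have gn : g n = n * q by rewrite /g on subnn; lia.
have [j ltj jmin] : exists2 j, j < n & forall k, k <= n -> g j <= g k.
  case: (@arg_minnP _ (Ordinal n0) xpredT (fun k : 'I_n => g k) isT) => j _ jmin.
  exists j => // k lek; have [->|ne] := eqVneq k n.
    by rewrite gn -g0; apply: (jmin (Ordinal n0)).
  have ltk : k < n by lia.
  exact: (jmin (Ordinal ltk)).
have [i lti gi] : exists2 i, i < n & g i + 1 = g j + n.
  (* Here q a is -1 modulo n. Since [g] is -q i modulo n, taking i = j - a modulo n gives g i = g j
     - 1 modulo n; minimality of [g j] and [gclose] leave only g j + n - 1. *)
  have [a lta] := Bezoutr q n0; rewrite gcdnC; move/eqP: (co) => -> /dvdnP [b bE].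
  have [i lti [c cE]] : exists2 i, i < n & exists c, q * i + q * a = q * j + n * c.
    case: (leqP a j) => [le|lt].
      by exists (j - a); [lia | exists 0; rewrite -mulnDr subnK //; lia].
    by exists (j + n - a); [lia | exists q; rewrite -mulnDr subnK; lia].
  exists i => //; have := jmin i ltac:(lia); have := gclose i j ltac:(lia) ltac:(lia).
  have := gE i ltac:(lia); have := gE j ltac:(lia) => ej ei lt le.
  have E : n * (ones w i + b) + g j = n * (ones w j + c) + g i + 1 by lia.
  have := mul_lt (ones w j + c) (ones w i + b) ltac:(lia).
  have := mul_lt (ones w i + b) (ones w j + c + 2) ltac:(lia).
  move=> h1 h2; have e : ones w i + b = ones w j + c + 1 by lia.
  by rewrite e in E; lia.
have jmax k : k <= n -> g k <= g i by move=> le; have := gclose k j le ltac:(lia); lia.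
(* A factor and its complement have total length n and q letters b, so their changes of [g]
   cancel. *)
have complement s t : s < t -> t <= n -> exists2 k, k + (n - (t - s)) <= n &
    g (k + (n - (t - s))) + g t = g k + g s.
  move=> lt le; have [|x [xw sx xE]] := ones_infix w s (t - s); first by rewrite -/n; lia.
  have [y [yw sy yE]] := symmetric_complement w x sym xw.
  have [k lek kE] := infix_ones y w yw; rewrite -/n -/q in sy yE lek.
  have {}sy : size y = n - (t - s) by lia.
  rewrite sy in lek kE; exists k => //; rewrite subnKC in xE; last exact: ltnW.
  have := gE s ltac:(lia); have := gE t le; have := gE k ltac:(lia); have := gE _ lek.
  rewrite -kE -xE.
  have : q * (k + (n - (t - s))) + q * t = q * k + q * n + q * s.
    by rewrite -!mulnDr; congr (_ * _); lia.
  have : n * count_mem lb x + n * count_mem lb y = n * q by rewrite -mulnDr yE.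
  by lia.
case: (ltngtP i j) => [lt|lt|eij]; last by move: gi; rewrite eij; lia.
  (* The complement climbs from the minimum to the maximum, so it starts at [j]; having length n -
     (j - i), it fits only if [i] is 0. Then D is never positive. *)
  have [k lek kE] := complement i j lt (ltnW ltj).
  have := jmin k ltac:(lia); have := jmax _ lek => h1 h2.
  have kj : k = j by apply: ginj; lia.
  have i0 : i = 0 by lia.
  rewrite i0 g0 in gi jmax.
  apply: (floor_slope_christoffel w j) => //; rewrite -/n -/q.
  - by move=> m le; have := gE m le; have := jmax m le; lia.
  - by move=> m le; have := gE m le; have := jmin m le; lia.
  - by have := gE j ltac:(lia); lia.
(* Now the minimum is at 0 and D is never negative. Reversal replaces D(m) by -D(n - m), which leads
   back to the floor case with cut point n - i. *)
have [k lek kE] := complement j i lt (ltnW lti).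
have := jmax k ltac:(lia); have := jmin _ lek => h1 h2.
have ki : k = i by apply: ginj; lia.
have j0 : j = 0 by lia.
rewrite j0 g0 in gi jmin lt.
have revE m : m <= n -> n * ones (rev w) m + n * ones w (n - m) = n * q.
  by move=> le; rewrite -mulnDr ones_rev.
have qE m : m <= n -> q * m + q * (n - m) = q * n by move=> le; rewrite -mulnDr subnKC.
apply: christoffel_rev; apply: (floor_slope_christoffel _ (n - i));
  rewrite size_rev ?count_rev -/n -/q //.
- move=> m le; have := gE (n - m) ltac:(lia); have := jmin (n - m) ltac:(lia).
  by have := revE m le; have := qE m le; lia.
- move=> m le; have := gE (n - m) ltac:(lia); have := jmax (n - m) ltac:(lia).
  by have := revE m le; have := qE m le; lia.
- by lia.
have := gE i ltac:(lia); have := revE (n - i) ltac:(lia); have := qE i ltac:(lia).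
rewrite subKn; last exact: ltnW.
by lia.
Qed.

Theorem theorem2 (w : word) :
  (strongly_factor_symmetric w -> support_symmetric w) /\
  (support_symmetric w -> primitive w -> sturmian w -> christoffel w).
Proof.
split.
  rewrite /strongly_factor_symmetric /support_symmetric /parikh => sym i j lei lej.
  by rewrite sym.
move=> sym prim [c [cc wc]]; apply: slope_bounded_christoffel => //.
apply: symmetric_slope => //; first exact: primitive_gt0.
exact: balanced_infix wc (christoffel_balanced c cc).
Qed.
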